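(* Let $i_1i_2\cdots i_{27}$, $j_1j_2\cdots j_{27}$ and $k_1k_2\cdots k_{27}$ be three arbitrary permutations of $123123\cdots123$ (of length $27$). For any paired symmetric (elasticity) tensor $\mathscr{A}\in\mathbb{T}_{6,3}$, suppose that $N$ is the unfolded matrix of $\mathscr{A}$ with respect to these indices. Then the following results hold: (i) if $N$ is positive semidefinite, then the polynomial $\mathscr{A}x^2y^2z^2$ is a sum of squares of trilinear forms; (ii) if $N$ is positive definite, then the polynomial $\mathscr{A}x^2y^2z^2$ is positive definite.
   Context: $\mathbb{T}_{6,3}$ is the set of real tensors $\mathscr{A}=(a_{ijklpq})$ with $i,j,k,l,p,q\in\{1,2,3\}$. $\mathscr{A}$ is paired symmetric if $a_{ijklpq}=a_{jiklpq}=a_{ijlkpq}=a_{ijklqp}$ for all indices; a paired symmetric tensor is an elasticity tensor if moreover $a_{ijklpq}=a_{klijpq}=a_{ijpqkl}$ for all indices. ''Paired symmetric (elasticity) tensor'' means that the statement is made for paired symmetric tensors and likewise for elasticity tensors. For $x,y,z\in\mathbb{R}^3$, $\mathscr{A}x^2y^2z^2:=\sum_{i,j,k,l,p,q=1}^3a_{ijklpq}x_ix_jy_ky_lz_pz_q$; it is positive definite if $\mathscr{A}x^2y^2z^2>0$ for all $x,y,z\in\mathbb{R}^3\setminus\{0\}$, and a sum of squares of trilinear forms if it equals $\sum_{s=1}^r\big(\sum_{i,k,p=1}^3\alpha^s_{ikp}x_iy_kz_p\big)^2$ identically for some $r\ge1$ and real $\alpha^s_{ikp}$. A permutation of $123123\cdots123$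 is a sequence of length 27 in which each of $1,2,3$ occurs nine times. The unfolded matrix of $\mathscr{A}$ with respect to $i_1\cdots i_{27}$, $j_1\cdots j_{27}$, $k_1\cdots k_{27}$ is $N=(n_{st})\in\mathbb{R}^{27\times27}$ with $n_{st}=a_{i_si_tj_sj_tk_sk_t}$ for $s,t\in\{1,\ldots,27\}$.
   Formalization: Part (i) is false for arbitrary permutations (e.g. all three equal); it is stated under the added assumption that the 27 index triples (i_s, j_s, k_s) are pairwise distinct, so N contains all entries of the tensor. Part (ii) is unchanged. *)

(* Defs.v *)
From HB Require Import structures.
From mathcomp Require Import all_boot all_order all_algebra.
From mathcomp Require Import reals.

Set Implicit Arguments.
Unset Strict Implicit.
Unset Printing Implicit Defensive.

Import Order.TTheory GRing.Theory Num.Theory.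
Local Open Scope ring_scope.

Definition tensor63 (R : realType) : Type :=
  'I_3 -> 'I_3 -> 'I_3 -> 'I_3 -> 'I_3 -> 'I_3 -> R.

Definition paired_symmetric (R : realType) (a : tensor63 R) : Prop :=
  forall i j k l p q : 'I_3,
    [/\ a i j k l p q = a j i k l p q,
        a i j k l p q = a i j l k p q &
        a i j k l p q = a i j k l q p].

Definition elasticity (R : realType) (a : tensor63 R) : Prop :=
  paired_symmetric a /\
  forall i j k l p q : 'I_3,
    a i j k l p q = a k l i j p q /\ a i j k l p q = a i j p q k l.

Definition tensor_form (R : realType) (a : tensor63 R) (x y z : 'rV[R]_3) : R :=
  \sum_(i < 3) \sum_(j < 3) \sum_(k < 3) \sum_(l < 3) \sum_(p < 3) \sum_(q < 3)
    a i j k l p q * x 0 i * x 0 j * y 0 k * y 0 l * z 0 p * z 0 q.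

Definition tensor_posdef (R : realType) (a : tensor63 R) : Prop :=
  forall x y z : 'rV[R]_3,
    x != 0 -> y != 0 -> z != 0 -> 0 < tensor_form a x y z.

Definition trilinear_form (R : realType) (alpha : 'I_3 -> 'I_3 -> 'I_3 -> R)
    (x y z : 'rV[R]_3) : R :=
  \sum_(i < 3) \sum_(k < 3) \sum_(p < 3) alpha i k p * x 0 i * y 0 k * z 0 p.

(* Identity of polynomials is identity of polynomial functions, R being
   infinite. *)
Definition sos_trilinear (R : realType) (a : tensor63 R) : Prop :=
  exists (r : nat) (alpha : 'I_r -> 'I_3 -> 'I_3 -> 'I_3 -> R),
    (1 <= r)%N /\
    forall x y z : 'rV[R]_3,
      tensor_form a x y z = \sum_(s < r) trilinear_form (alpha s) x y z ^+ 2.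

Definition mx_psd (R : realType) (n : nat) (N : 'M[R]_n) : Prop :=
  N^T = N /\ forall v : 'cV[R]_n, 0 <= (v^T *m N *m v) 0 0.

Definition mx_posdef (R : realType) (n : nat) (N : 'M[R]_n) : Prop :=
  N^T = N /\ forall v : 'cV[R]_n, v != 0 -> 0 < (v^T *m N *m v) 0 0.

(* The letters 1, 2, 3 are the elements 0, 1, 2 of 'I_3. *)
Definition perm_word (w : 27.-tuple 'I_3) : Prop :=
  forall c : 'I_3, count_mem c w = 9%N.

Definition unfolded_mx (R : realType) (a : tensor63 R)
    (i j k : 27.-tuple 'I_3) : 'M[R]_27 :=
  \matrix_(s < 27, t < 27)
    a (tnth i s) (tnth i t) (tnth j s) (tnth j t) (tnth k s) (tnth k t).

(* Each of the 27 index triples labels exactly one row, so that [unfolded_mx]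
   is a rearrangement of all the 729 entries of the tensor. This does not follow
   from [perm_word i], [perm_word j], [perm_word k]: if i = j = k, the unfolded
   matrix involves no entry such as a_{112211}, and it can vanish while the form
   of the tensor takes negative values. If the unfolded matrix is positive
   definite, no two of its rows coincide and the condition is automatic. *)
Definition exhaustive_words (i j k : 27.-tuple 'I_3) : Prop :=
  injective (fun s : 'I_27 => (tnth i s, tnth j s, tnth k s)).

(* Main.v *)
(** When the words enumerate all index triples, [A x^2 y^2 z^2] is the value of
    the quadratic form of [N] at the vector [v] with entries
    [x_(i_s) y_(j_s) z_(k_s)]. A Gram factorisation [N = L^T L] then gives
    [A x^2 y^2 z^2 = |L v|^2], and the entries of [L v] are trilinear forms.
    If [N] is positive definite, its rows are distinct, so the words do
    enumerate all triples, and [v] is nonzero when [x], [y] and [z] are. *)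

Require Import Defs.
From mathcomp Require Import all_boot all_order all_algebra.
From mathcomp Require Import reals.
From mathcomp Require Import ring.

Set Implicit Arguments.
Unset Strict Implicit.
Unset Printing Implicit Defensive.

Import Order.TTheory GRing.Theory Num.Theory.
Local Open Scope ring_scope.

Lemma mulmx_tr_selfE (R : comPzRingType) (n : nat) (v : 'cV[R]_n) :
  (v^T *m v) 0 0 = \sum_s v s 0 ^+ 2.
Proof. by rewrite mxE; apply: eq_bigr => s _; rewrite mxE expr2. Qed.

Lemma quad_mxE (R : comPzRingType) (n : nat) (N : 'M[R]_n) (v : 'cV[R]_n) :
  (v^T *m N *m v) 0 0 = \sum_s \sum_t N s t * v s 0 * v t 0.
Proof.
rewrite mxE exchange_big /=; apply: eq_bigr => t _.
rewrite mxE mulr_suml; apply: eq_bigr => s _.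
by rewrite mxE [v s 0 * _]mulrC.
Qed.

Section Gram.
Variable R : realType.

(** Splitting off the first coordinate shows the form as a quadratic polynomial in [t], so
    positivity can be tested at well-chosen values of [t]. *)
Lemma quad_block_mxE (n : nat) (a : R) (b : 'rV[R]_n) (C : 'M[R]_n)
    (t : R) (w : 'cV[R]_n) :
  ((col_mx t%:M w)^T *m block_mx a%:M b b^T C *m col_mx t%:M w) 0 0
  = a * t ^+ 2 + t * (b *m w) 0 0 *+ 2 + (w^T *m C *m w) 0 0.
Proof.
have bw : w^T *m b^T = b *m w.
  by rewrite -trmx_mul [b *m w]mx11_scalar tr_scalar_mx.
rewrite tr_col_mx mul_row_block mul_row_col tr_scalar_mx !mulmxDl bw.
rewrite -scalar_mxM -!mulmxA [b *m (w *m _)]mulmxA.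
move: (b *m w) (w^T *m (C *m w)) => u c.
rewrite !mul_scalar_mx !mul_mx_scalar !mxE eqxx !mulr1n; ring.
Qed.

(** With a zero corner the form is affine in the first coordinate; on vectors ending in [b^T] its
    slope is twice the squared norm of [b], so a nonzero [b] would make it negative somewhere. *)
Lemma psd_corner0 (n : nat) (b : 'rV[R]_n) (C : 'M[R]_n) :
  mx_psd (block_mx (0 : R)%:M b b^T C) -> b = 0.
Proof.
move=> [_ psd].
have bb : (b *m b^T) 0 0 = \sum_s b 0 s ^+ 2.
  by rewrite -{1}[b]trmxK mulmx_tr_selfE; apply: eq_bigr => s _; rewrite mxE.
have bb0 : (b *m b^T) 0 0 = 0.
  apply/eqP/negPn/negP => nz.
  set c := (b^T^T *m C *m b^T) 0 0.
  (* The first coordinate is solved for so that the form takes the value -1. *)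
  have := psd (col_mx (- (c + 1) / ((b *m b^T) 0 0 *+ 2))%:M b^T).
  rewrite quad_block_mxE -/c.
  suff -> : forall u : R, u != 0 ->
      0 * (- (c + 1) / (u *+ 2)) ^+ 2 + - (c + 1) / (u *+ 2) * u *+ 2 + c = -1.
  - by rewrite lerNr oppr0 ler10.
  - by [].
  by move=> u u0; field.
apply/rowP => s; rewrite mxE; apply/eqP.
move/eqP: bb0; rewrite bb psumr_eq0 => [/allP/(_ s)|t _]; last exact: sqr_ge0.
by rewrite mem_index_enum sqrf_eq0 => /(_ isT).
Qed.

(* The junk value 0^-1 = 0 lets the Schur complement formula cover the case of
   a zero corner, in which [b] vanishes. *)
Lemma psd_gram (n : nat) (N : 'M[R]_n) :
  mx_psd N -> exists L : 'M[R]_n, N = L^T *m L.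
Proof.
elim: n N => [|n IHn] N; first by exists 0; rewrite [N]thinmx0 [RHS]thinmx0.
rewrite -[n.+1]/(1 + n)%N in N *.
rewrite -(submxK N) [ulsubmx N]mx11_scalar.
set a := ulsubmx N 0 0; set b := ursubmx N; set C := drsubmx N.
move=> psdN; have [symN _] := psdN.
move: symN; rewrite tr_block_mx => /eq_block_mx[_ _ bE symC].
rewrite -bE in psdN *.
have [_ psd] := psdN.
have a_ge0 : 0 <= a.
  have := psd (col_mx 1%:M 0).
  by rewrite quad_block_mxE !mulmx0 !mxE expr1n mulr1 mulr0 mul0rn !addr0.
have ab0 : a = 0 -> b = 0.
  by move=> a0; move: psdN; rewrite a0; apply: psd_corner0.
have aVb : (a * a^-1) *: b = b.
  have [a0|nz] := eqVneq a 0; first by rewrite (ab0 a0) scaler0.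
  by rewrite mulfV // scale1r.
pose S := C - a^-1 *: (b^T *m b).
have psdS : mx_psd S.
  split=> [|w].
    by rewrite linearB linearZ /= trmx_mul trmxK symC.
  have -> : (w^T *m S *m w) 0 0
      = (w^T *m C *m w) 0 0 - a^-1 * (b *m w) 0 0 ^+ 2.
    rewrite mulmxBr mulmxBl -scalemxAr -scalemxAl mulmxA -mulmxA.
    have -> : w^T *m b^T = b *m w.
      by rewrite -trmx_mul [b *m w]mx11_scalar tr_scalar_mx.
    rewrite -[b *m w *m b *m w]mulmxA.
    by rewrite [b *m w]mx11_scalar -scalar_mxM !mxE eqxx !mulr1n expr2.
  (* For [a > 0] this first coordinate minimises the form with [w] fixed, and the minimum is the
     form of the Schur complement [S] at [w]. For [a = 0] it is 0, and [S] is [C]. *)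
  have := psd (col_mx (- (a^-1 * (b *m w) 0 0))%:M w).
  rewrite quad_block_mxE; congr (0 <= _).
  have [a0|nz] := eqVneq a 0; first by rewrite a0 invr0; ring.
  by field.
have [L SE] := IHn S psdS.
(* One step of the Cholesky factorisation: [Num.sqrt a * a^-1] stands for the inverse square root of
   [a], and is 0 when [a = 0]. The off-diagonal block of the product is [(a * a^-1) *: b], hence [b]
   by [aVb]. *)
exists (block_mx (Num.sqrt a)%:M ((Num.sqrt a * a^-1) *: b) 0 L).
rewrite tr_block_mx mulmx_block !trmx0 !mul0mx !mulmx0 !addr0 -SE.
rewrite tr_scalar_mx [(_ *: b)^T]linearZ /= -scalar_mxM -expr2 sqr_sqrtr //.
rewrite mul_scalar_mx mul_mx_scalar !scalerA mulrA -expr2 sqr_sqrtr // aVb.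
rewrite -scalemxAl -scalemxAr scalerA.
have -> : Num.sqrt a * a^-1 * (Num.sqrt a * a^-1) = a^-1.
  rewrite mulrACA -expr2 sqr_sqrtr //.
  have [->|nz] := eqVneq a 0; first by rewrite mul0r invr0.
  by rewrite mulrA mulfV // mul1r.
have -> : (a * a^-1) *: b^T = b^T by rewrite -linearZ /= aVb.
by rewrite addrC subrK.
Qed.

End Gram.

(** If rows [s] and [t] agree, the difference of the two basis vectors is annihilated by [N] from
    the left, so the form vanishes at a nonzero vector. *)
Lemma posdef_rows_neq (R : realType) (n : nat) (N : 'M[R]_n) (s t : 'I_n) :
  mx_posdef N -> row s N = row t N -> s = t.
Proof.
move=> [_ pos] eq_row; apply/eqP/negPn/negP => neq_st.
pose v : 'cV[R]_n := delta_mx s 0 - delta_mx t 0.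
have v0 : v != 0.
  apply/eqP => /colP/(_ s); rewrite !mxE !eqxx (negPf neq_st) subr0.
  by move/eqP; rewrite oner_eq0.
have := pos v v0.
by rewrite [v^T]linearB /= !trmx_delta mulmxBl -!rowE eq_row subrr mul0mx mxE ltxx.
Qed.

Section Words.
Variables (R : realType) (i j k : 27.-tuple 'I_3).

Definition word_monomials (x y z : 'rV[R]_3) : 'cV[R]_27 :=
  \col_s (x 0 (tnth i s) * y 0 (tnth j s) * z 0 (tnth k s)).

Hypothesis ex : exhaustive_words i j k.

Lemma exhaustive_words_bij :
  bijective (fun s : 'I_27 => (tnth i s, tnth j s, tnth k s)).
Proof. by apply: inj_card_bij ex _; rewrite !card_prod !card_ord. Qed.

Lemma big_exhaustive_words (F : 'I_3 -> 'I_3 -> 'I_3 -> R) :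
  \sum_(s < 27) F (tnth i s) (tnth j s) (tnth k s)
  = \sum_(a < 3) \sum_(b < 3) \sum_(c < 3) F a b c.
Proof.
rewrite pair_bigA pair_bigA /=.
by rewrite (reindex _ (onW_bij _ exhaustive_words_bij)).
Qed.

Lemma tensor_form_unfolded (A : tensor63 R) (x y z : 'rV[R]_3) :
  let v := word_monomials x y z in
  tensor_form A x y z = (v^T *m unfolded_mx A i j k *m v) 0 0.
Proof.
rewrite /= quad_mxE.
pose G a a' b b' c c' := A a a' b b' c c' * (x 0 a * y 0 b * z 0 c)
  * (x 0 a' * y 0 b' * z 0 c').
transitivity (\sum_(s < 27) \sum_(t < 27)
    G (tnth i s) (tnth i t) (tnth j s) (tnth j t) (tnth k s) (tnth k t));
  last by apply: eq_bigr => s _; apply: eq_bigr => t _; rewrite !mxE.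
rewrite (big_exhaustive_words (fun a b c =>
  \sum_(t < 27) G a (tnth i t) b (tnth j t) c (tnth k t))).
under [RHS]eq_bigr => a _ do under eq_bigr => b _ do under eq_bigr => c _ do
  rewrite (big_exhaustive_words (fun a' b' c' => G a a' b b' c c')).
rewrite /tensor_form; apply: eq_bigr => a _.
(* The form sums over [a a' b b' c c'], the right-hand side over [a b c a' b' c']; the exchanges
   align the two orders one index at a time. *)
rewrite exchange_big; apply: eq_bigr => b _ /=.
rewrite [RHS]exchange_big; apply: eq_bigr => a' _ /=.
rewrite [RHS]exchange_big; apply: eq_bigr => b' _ /=.
by do 2![apply: eq_bigr => ? _]; rewrite /G; ring.
Qed.

Lemma unfolded_psd_sos (A : tensor63 R) :
  mx_psd (unfolded_mx A i j k) -> sos_trilinear A.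
Proof.
move=> /psd_gram[L NE]; have [g fK gK] := exhaustive_words_bij.
(* Row [s] of [L] gives the coefficients of the [s]-th form, with [g] sending an index triple to the
   column that it labels. *)
exists 27, (fun s a b c => L s (g (a, b, c))); split=> // x y z.
rewrite tensor_form_unfolded NE mulmxA -trmx_mul -mulmxA mulmx_tr_selfE.
apply: eq_bigr => s _; congr (_ ^+ 2).
rewrite /trilinear_form -(big_exhaustive_words (fun a b c =>
  L s (g (a, b, c)) * x 0 a * y 0 b * z 0 c)) mxE.
by apply: eq_bigr => t _; rewrite fK mxE !mulrA.
Qed.

Lemma word_monomials_neq0 (x y z : 'rV[R]_3) :
  x != 0 -> y != 0 -> z != 0 -> word_monomials x y z != 0.
Proof.
move=> /rV0Pn[a xa] /rV0Pn[b yb] /rV0Pn[c zc].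
have [g _ gK] := exhaustive_words_bij.
(* The entry labelled by the positions of nonzero coordinates of [x], [y], [z] is a product of three
   nonzero numbers. *)
apply/cV0Pn; exists (g (a, b, c)).
by have [iE jE kE] := gK (a, b, c); rewrite mxE iE jE kE !mulf_neq0.
Qed.

End Words.

Lemma posdef_exhaustive_words (R : realType) (i j k : 27.-tuple 'I_3)
    (A : tensor63 R) :
  mx_posdef (unfolded_mx A i j k) -> exhaustive_words i j k.
Proof.
move=> posN s t [iE jE kE]; apply: (posdef_rows_neq posN).
by apply/rowP => u; rewrite !mxE iE jE kE.
Qed.

Theorem theorem5p11 (R : realType) (i j k : 27.-tuple 'I_3)
    (hi : perm_word i) (hj : perm_word j) (hk : perm_word k)
    (A : tensor63 R) (hA : paired_symmetric A \/ elasticity A)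
    (N : 'M[R]_27) (hN : N = unfolded_mx A i j k) :
  (exhaustive_words i j k -> mx_psd N -> sos_trilinear A) /\
  (mx_posdef N -> tensor_posdef A).
Proof.
rewrite hN; split=> [ex|posN x y z x0 y0 z0]; first exact: unfolded_psd_sos ex _.
have ex := posdef_exhaustive_words posN.
by rewrite (tensor_form_unfolded ex); apply: posN.2; apply: word_monomials_neq0.
Qed.
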